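(* Let $X$ be a real reflexive Banach space, let $F\colon X\to X^*$ be (single-valued, everywhere defined) maximal monotone, strictly monotone, 3*-monotone and surjective, and let $A\colon X\rightrightarrows X^*$ be monotone. Then $A$ is maximal monotone if and only if $\operatorname{ran}(A+F)=X^*$.
   Context: $X^*$ is the dual of $X$ with pairing $\langle\cdot,\cdot\rangle$. For set-valued $A\colon X\rightrightarrows X^*$: graph, domain, range as usual; monotone means $\langle x-y,x^*-y^*\rangle\ge0$ for all $(x,x^* ),(y,y^* )\in\operatorname{gra}A$; maximal monotone means no proper monotone extension of the graph. $(A+F)x=Ax+Fx$ for $x\in\operatorname{dom}A$. $F$ strictly monotone: $\langle x-y,Fx-Fy\rangle>0$ whenever $x\neq y$. $F$ is 3*-monotone: for every $(x,x^* )\in X\times X^*$, $\sup_{y\in X}\langle x-y,Fy-x^*\rangle<+\infty$. *)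

(* Defs.v *)
From Stdlib Require Import Reals.
Open Scope R_scope.

Record NormedSpace := {
  ns_car :> Type;
  ns_zero : ns_car;
  ns_add : ns_car -> ns_car -> ns_car;
  ns_opp : ns_car -> ns_car;
  ns_scal : R -> ns_car -> ns_car;
  ns_norm : ns_car -> R;
  ns_add_assoc : forall x y z, ns_add x (ns_add y z) = ns_add (ns_add x y) z;
  ns_add_comm : forall x y, ns_add x y = ns_add y x;
  ns_add_zero : forall x, ns_add x ns_zero = x;
  ns_add_opp : forall x, ns_add x (ns_opp x) = ns_zero;
  ns_scal_assoc : forall a b x, ns_scal a (ns_scal b x) = ns_scal (a * b) x;
  ns_scal_one : forall x, ns_scal 1 x = x;
  ns_scal_distr_l : forall a x y, ns_scal a (ns_add x y) = ns_add (ns_scal a x) (ns_scal a y);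
  ns_scal_distr_r : forall a b x, ns_scal (a + b) x = ns_add (ns_scal a x) (ns_scal b x);
  ns_norm_nonneg : forall x, 0 <= ns_norm x;
  ns_norm_eq0 : forall x, ns_norm x = 0 -> x = ns_zero;
  ns_norm_scal : forall a x, ns_norm (ns_scal a x) = Rabs a * ns_norm x;
  ns_norm_triangle : forall x y, ns_norm (ns_add x y) <= ns_norm x + ns_norm y
}.

Arguments ns_zero {n}.
Arguments ns_add {n} _ _.
Arguments ns_opp {n} _.
Arguments ns_scal {n} _ _.
Arguments ns_norm {n} _.

Definition ns_sub {X : NormedSpace} (x y : X) : X := ns_add x (ns_opp y).

Definition complete (X : NormedSpace) : Prop :=
  forall u : nat -> X,
    (forall eps, 0 < eps -> exists N, forall m n, (N <= m)%nat -> (N <= n)%nat ->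
        ns_norm (ns_sub (u m) (u n)) < eps) ->
    exists l : X, forall eps, 0 < eps -> exists N, forall n, (N <= n)%nat ->
        ns_norm (ns_sub (u n) l) < eps.

Definition is_linear {X : NormedSpace} (f : X -> R) : Prop :=
  (forall x y, f (ns_add x y) = f x + f y) /\ (forall a x, f (ns_scal a x) = a * f x).

Definition bounded_by {X : NormedSpace} (f : X -> R) (K : R) : Prop :=
  forall x, Rabs (f x) <= K * ns_norm x.

Record dual (X : NormedSpace) := mkDual {
  dfun :> X -> R;
  dfun_lin : is_linear dfun;
  dfun_bdd : exists K, bounded_by dfun K
}.
Arguments dfun {X} _ _.

Definition pairing {X : NormedSpace} (x : X) (xs : dual X) : R := dfun xs x.

(* Reflexivity: every continuous linear functional on X-dual (with the dual norm)
   is evaluation at some point of X, i.e. the canonical embedding X -> X-bidual is onto. *)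
Definition reflexive (X : NormedSpace) : Prop :=
  forall phi : dual X -> R,
    (forall f g h : dual X, (forall x, dfun h x = dfun f x + dfun g x) ->
        phi h = phi f + phi g) ->
    (forall (a : R) (f g : dual X), (forall x, dfun g x = a * dfun f x) ->
        phi g = a * phi f) ->
    (exists M, forall (f : dual X) (K : R), 0 <= K -> bounded_by (dfun f) K ->
        Rabs (phi f) <= M * K) ->
    exists x : X, forall f : dual X, phi f = dfun f x.

Definition reflexive_Banach (X : NormedSpace) : Prop := complete X /\ reflexive X.

Definition setop (X : NormedSpace) := X -> dual X -> Prop.

Definition monotone {X : NormedSpace} (A : setop X) : Prop :=
  forall x xs y ys, A x xs -> A y ys ->
    0 <= pairing (ns_sub x y) xs - pairing (ns_sub x y) ys.

Definition maximal_monotone {X : NormedSpace} (A : setop X) : Prop :=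
  monotone A /\
  forall B : setop X, monotone B -> (forall x xs, A x xs -> B x xs) ->
    forall x xs, B x xs -> A x xs.

Definition graph_of {X : NormedSpace} (F : X -> dual X) : setop X :=
  fun x xs => xs = F x.

Definition strictly_monotone {X : NormedSpace} (F : X -> dual X) : Prop :=
  forall x y, x <> y -> 0 < pairing (ns_sub x y) (F x) - pairing (ns_sub x y) (F y).

Definition three_star_monotone {X : NormedSpace} (F : X -> dual X) : Prop :=
  forall (x : X) (xs : dual X), exists M : R, forall y : X,
    pairing (ns_sub x y) (F y) - pairing (ns_sub x y) xs <= M.

Definition surjective_op {X : NormedSpace} (F : X -> dual X) : Prop :=
  forall ys : dual X, exists x, F x = ys.

Definition range_sum_full {X : NormedSpace} (A : setop X) (F : X -> dual X) : Prop :=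
  forall ys : dual X, exists (x : X) (xs : dual X),
    A x xs /\ forall z : X, dfun ys z = dfun xs z + dfun (F x) z.

(* Main.v *)
(* If [ran (A + F)] is everything and [(x, x')] is monotonically related to [A], solve
   [y' + F y = x' + F x] with [y'] in [A y]; strict monotonicity of [F] forces [y = x].

   Conversely, after translating [F] it is enough to find a zero of [A + F].  The
   Fitzpatrick functions satisfy [phi_A(x, x') >= <x, x'>] and
   [phi_F(x, -x') >= -<x, x'>], so their sum is nonnegative.  As [F] is 3*-monotone,
   [phi_F] is finite everywhere, hence locally bounded by completeness, so Fenchel
   duality gives an affine continuous function between [-phi_F(x, -x')] and [phi_A].
   By reflexivity its slope is a pair [(z', z)], and evaluating on the graphs gives
   equality in both Fitzpatrick inequalities at [(z, z')]: by maximality [z'] lies in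
   [A z] and [-z' = F z]. *)
Require Import Defs.
From Stdlib Require Import Reals Lra Lia Classical ProofIrrelevance
  FunctionalExtensionality IndefiniteDescription.
From mathcomp Require classical_sets.
Open Scope R_scope.

(** * Vector and norm identities *)

Lemma scal_zero (X : NormedSpace) (x : X) : ns_scal 0 x = ns_zero.
Proof.
apply ns_norm_eq0; rewrite ns_norm_scal, Rabs_R0; ring.
Qed.

Lemma norm_zero (X : NormedSpace) : ns_norm (@ns_zero X) = 0.
Proof.
rewrite <- (scal_zero X ns_zero), ns_norm_scal, Rabs_R0; ring.
Qed.

Lemma add_zero_l (X : NormedSpace) (x : X) : ns_add ns_zero x = x.
Proof. rewrite ns_add_comm; apply ns_add_zero. Qed.

Lemma scal_vzero (X : NormedSpace) (a : R) : ns_scal a (@ns_zero X) = ns_zero.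
Proof.
apply ns_norm_eq0; rewrite ns_norm_scal, norm_zero; ring.
Qed.

Lemma add_eq_zero (X : NormedSpace) (x y : X) :
  ns_add x y = ns_zero -> x = ns_opp y.
Proof.
intro H.
rewrite <- (ns_add_zero _ x), <- (ns_add_opp _ y), ns_add_assoc, H.
apply add_zero_l.
Qed.

Lemma opp_scal (X : NormedSpace) (x : X) : ns_opp x = ns_scal (-1) x.
Proof.
symmetry; apply add_eq_zero.
rewrite <- (ns_scal_one _ x) at 2.
rewrite <- ns_scal_distr_r.
replace (-1 + 1) with 0 by ring.
apply scal_zero.
Qed.

Lemma add_shuffle (X : NormedSpace) (a b c d : X) :
  ns_add (ns_add a b) (ns_add c d) = ns_add (ns_add a c) (ns_add b d).
Proof.
rewrite <- !ns_add_assoc; f_equal.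
rewrite !ns_add_assoc; f_equal; apply ns_add_comm.
Qed.

Lemma add_sub (X : NormedSpace) (x h : X) : ns_sub (ns_add x h) x = h.
Proof.
unfold ns_sub.
now rewrite (ns_add_comm _ x h), <- ns_add_assoc, ns_add_opp, ns_add_zero.
Qed.

Lemma sub_sub (X : NormedSpace) (x y z : X) :
  ns_add (ns_sub x y) (ns_sub y z) = ns_sub x z.
Proof.
unfold ns_sub.
rewrite ns_add_assoc; f_equal.
rewrite <- ns_add_assoc, (ns_add_comm _ (ns_opp y) y), ns_add_opp.
apply ns_add_zero.
Qed.

Lemma norm_sub_triangle (X : NormedSpace) (x y z : X) :
  ns_norm (ns_sub x z) <= ns_norm (ns_sub x y) + ns_norm (ns_sub y z).
Proof. rewrite <- (sub_sub X x y z); apply ns_norm_triangle. Qed.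

Lemma norm_opp (X : NormedSpace) (x : X) : ns_norm (ns_opp x) = ns_norm x.
Proof.
rewrite opp_scal, ns_norm_scal, Rabs_left by lra; ring.
Qed.

Lemma norm_sub_sym (X : NormedSpace) (x y : X) :
  ns_norm (ns_sub x y) = ns_norm (ns_sub y x).
Proof.
rewrite <- (norm_opp X (ns_sub y x)); f_equal.
apply add_eq_zero; rewrite sub_sub; apply ns_add_opp.
Qed.

Lemma norm_sub_self (X : NormedSpace) (x : X) : ns_norm (ns_sub x x) = 0.
Proof. unfold ns_sub; rewrite ns_add_opp; apply norm_zero. Qed.

Lemma linear_zero (X : NormedSpace) (f : X -> R) : is_linear f -> f ns_zero = 0.
Proof.
intros [_ H]. rewrite <- (scal_zero X ns_zero), H; ring.
Qed.

Lemma linear_opp (X : NormedSpace) (f : X -> R) (x : X) :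
  is_linear f -> f (ns_opp x) = - f x.
Proof. intros [_ H]. rewrite opp_scal, H; ring. Qed.

Lemma linear_sub (X : NormedSpace) (f : X -> R) (x y : X) :
  is_linear f -> f (ns_sub x y) = f x - f y.
Proof.
intro H; unfold ns_sub; rewrite (proj1 H), linear_opp by assumption; ring.
Qed.

(** * The dual space *)

(** Proof irrelevance removes the linearity and boundedness certificates, so identities in the dual
    can be checked pointwise. *)
Lemma dual_ext (X : NormedSpace) (f g : dual X) :
  (forall x, dfun f x = dfun g x) -> f = g.
Proof.
destruct f as [f fl fb], g as [g gl gb]; simpl; intro H.
assert (f = g) by (now apply functional_extensionality); subst g.
f_equal; apply proof_irrelevance.
Qed.

Lemma dual_add_subproof (X : NormedSpace) (f g : dual X) :
  is_linear (fun x => f x + g x) /\ exists K, bounded_by (fun x => f x + g x) K.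
Proof.
destruct f as [f [fa fs] [K fb]], g as [g [ga gs] [K' gb]]; simpl.
split; [split|].
- intros; rewrite fa, ga; ring.
- intros; rewrite fs, gs; ring.
- exists (K + K'); intro x. specialize (fb x). specialize (gb x).
  pose proof (Rabs_triang (f x) (g x)). lra.
Qed.

Definition dual_add {X : NormedSpace} (f g : dual X) : dual X :=
  mkDual X _ (proj1 (dual_add_subproof X f g)) (proj2 (dual_add_subproof X f g)).

Lemma bounded_by_scal (X : NormedSpace) (f : X -> R) (a K : R) :
  bounded_by f K -> bounded_by (fun x => a * f x) (Rabs a * K).
Proof.
intros fb x. rewrite Rabs_mult, Rmult_assoc.
apply Rmult_le_compat_l; [apply Rabs_pos|apply fb].
Qed.

Lemma dual_scal_subproof (X : NormedSpace) (a : R) (f : dual X) :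
  is_linear (fun x => a * f x) /\ exists K, bounded_by (fun x => a * f x) K.
Proof.
destruct f as [f [fa fs] [K fb]]; simpl.
split; [split|].
- intros; rewrite fa; ring.
- intros; rewrite fs; ring.
- exists (Rabs a * K). now apply bounded_by_scal.
Qed.

Definition dual_scal {X : NormedSpace} (a : R) (f : dual X) : dual X :=
  mkDual X _ (proj1 (dual_scal_subproof X a f)) (proj2 (dual_scal_subproof X a f)).

Lemma dual_zero_subproof (X : NormedSpace) :
  is_linear (fun _ : X => 0) /\ exists K, bounded_by (fun _ : X => 0) K.
Proof.
split; [split; intros; ring|].
exists 0; intro x; rewrite Rabs_R0; lra.
Qed.

Definition dual_zero {X : NormedSpace} : dual X :=
  mkDual X _ (proj1 (dual_zero_subproof X)) (proj2 (dual_zero_subproof X)).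

Lemma bounded_by_ge0 (X : NormedSpace) (f : X -> R) (K : R) :
  bounded_by f K -> bounded_by f (Rmax 0 K).
Proof.
intros fb x. eapply Rle_trans; [apply fb|].
apply Rmult_le_compat_r; [apply ns_norm_nonneg|apply Rmax_r].
Qed.

(** The infimum of all bounds is again a bound, since each bound dominates every quotient
    [Rabs (f x) / ns_norm x]. It is obtained as minus the supremum of the negated bounds. *)
Lemma dual_norm_exists (X : NormedSpace) (f : dual X) :
  exists N, 0 <= N /\ bounded_by f N /\ forall K, 0 <= K -> bounded_by f K -> N <= K.
Proof.
destruct (completeness (fun r => exists K, 0 <= K /\ bounded_by f K /\ r = - K))
  as [m [ub lub]].
- exists 0; intros r (K & H & _ & ->); lra.
- destruct (dfun_bdd _ f) as [K fb].
  exists (- Rmax 0 K), (Rmax 0 K).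
  split; [apply Rmax_l|]. split; [now apply bounded_by_ge0|reflexivity].
- exists (- m). split; [|split].
  + apply Ropp_0_ge_le_contravar, Rle_ge, lub.
    intros r (K & H & _ & ->); lra.
  + intro x. apply Rnot_lt_le; intro Hx.
    pose proof (ns_norm_nonneg X x) as [Hn|Hn].
    * enough (m <= - (Rabs (f x) / ns_norm x)) as H.
      { apply (Rmult_le_compat_r (ns_norm x)) in H; [|lra].
        replace (- (Rabs (f x) / ns_norm x) * ns_norm x) with (- Rabs (f x)) in H
          by (field; lra).
        lra. }
      apply lub; intros r (K & _ & fb & ->). specialize (fb x).
      apply Ropp_le_contravar.
      apply (Rmult_le_reg_r (ns_norm x)); [assumption|].
      replace (Rabs (f x) / ns_norm x * ns_norm x) with (Rabs (f x)) by (field; lra).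
      assumption.
    * symmetry in Hn. destruct (dfun_bdd _ f) as [K fb]. specialize (fb x).
      rewrite Hn in *. lra.
  + intros K HK fb. enough (- K <= m) by lra. apply ub. now exists K.
Qed.

Definition dual_norm {X : NormedSpace} (f : dual X) : R :=
  proj1_sig (constructive_indefinite_description _ (dual_norm_exists X f)).

Lemma dual_norm_ge0 (X : NormedSpace) (f : dual X) : 0 <= dual_norm f.
Proof. apply (proj2_sig (constructive_indefinite_description _ (dual_norm_exists X f))). Qed.

Lemma dual_norm_bounded (X : NormedSpace) (f : dual X) : bounded_by f (dual_norm f).
Proof. apply (proj2_sig (constructive_indefinite_description _ (dual_norm_exists X f))). Qed.

Lemma dual_norm_le (X : NormedSpace) (f : dual X) (K : R) :
  0 <= K -> bounded_by f K -> dual_norm f <= K.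
Proof. apply (proj2_sig (constructive_indefinite_description _ (dual_norm_exists X f))). Qed.

Lemma dual_norm_eq0 (X : NormedSpace) (f : dual X) : dual_norm f = 0 -> f = dual_zero.
Proof.
intro H; apply dual_ext; intro x; simpl.
pose proof (dual_norm_bounded X f x) as Hb; rewrite H in Hb.
revert Hb; unfold Rabs; destruct Rcase_abs; lra.
Qed.

Lemma dual_norm_scal_le (X : NormedSpace) (a : R) (f : dual X) :
  dual_norm (dual_scal a f) <= Rabs a * dual_norm f.
Proof.
apply dual_norm_le.
- apply Rmult_le_pos; [apply Rabs_pos|apply dual_norm_ge0].
- apply bounded_by_scal, dual_norm_bounded.
Qed.

(** For [a] nonzero the reverse inequality is [dual_norm_scal_le] applied to [/ a] and
    [dual_scal a f]. *)
Lemma dual_norm_scal (X : NormedSpace) (a : R) (f : dual X) :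
  dual_norm (dual_scal a f) = Rabs a * dual_norm f.
Proof.
apply Rle_antisym; [apply dual_norm_scal_le|].
destruct (Req_dec a 0) as [->|Ha].
- rewrite Rabs_R0, Rmult_0_l. apply dual_norm_ge0.
- pose proof (dual_norm_scal_le X (/ a) (dual_scal a f)) as H.
  replace (dual_scal (/ a) (dual_scal a f)) with f in H
    by (apply dual_ext; intro x; simpl; field; assumption).
  apply (Rmult_le_compat_l (Rabs a)) in H; [|apply Rabs_pos].
  rewrite <- Rmult_assoc, <- Rabs_mult, Rinv_r, Rabs_R1, Rmult_1_l in H; assumption.
Qed.

Lemma dual_norm_triangle (X : NormedSpace) (f g : dual X) :
  dual_norm (dual_add f g) <= dual_norm f + dual_norm g.
Proof.
apply dual_norm_le.
- pose proof (dual_norm_ge0 X f); pose proof (dual_norm_ge0 X g); lra.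
- intro x; simpl.
  pose proof (dual_norm_bounded X f x); pose proof (dual_norm_bounded X g x).
  pose proof (Rabs_triang (f x) (g x)); lra.
Qed.

(** Left transparent, so that its carrier and operations compute to those of [dual X]. *)
Definition dualNS (X : NormedSpace) : NormedSpace.
Proof.
refine {| ns_car := dual X; ns_zero := dual_zero; ns_add := dual_add;
  ns_opp := dual_scal (-1); ns_scal := dual_scal; ns_norm := dual_norm;
  ns_norm_nonneg := dual_norm_ge0 X; ns_norm_eq0 := dual_norm_eq0 X;
  ns_norm_scal := dual_norm_scal X; ns_norm_triangle := dual_norm_triangle X |};
  intros; apply dual_ext; intro; simpl; ring.
Defined.

(** The limit is taken pointwise. Letting one index of the Cauchy estimate go to infinity makes the
    convergence uniform relative to [ns_norm x], which gives both boundedness of the limit and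
    convergence in norm. *)
Lemma dual_complete (X : NormedSpace) : complete (dualNS X).
Proof.
intros u Hu.
assert (Hd : forall m n x, Rabs (dfun (u m) x - dfun (u n) x)
    <= ns_norm (ns_sub (u m) (u n)) * ns_norm x).
{ intros m n x.
  pose proof (dual_norm_bounded X (ns_sub (u m) (u n)) x) as H; simpl in H.
  now replace (dfun (u m) x - dfun (u n) x) with (dfun (u m) x + -1 * dfun (u n) x)
    by ring. }
assert (Hc : forall x, exists l, Un_cv (fun n => dfun (u n) x) l).
{ intro x.
  destruct (R_complete (fun n => dfun (u n) x)) as [l Hl]; [|now exists l].
  intros eps Heps.
  pose proof (ns_norm_nonneg X x) as Hx.
  destruct (Hu (eps / (ns_norm x + 1))) as [N HN];
    [apply Rdiv_lt_0_compat; lra|].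
  exists N; intros m n Hm Hn. unfold R_dist.
  eapply Rle_lt_trans; [apply Hd|].
  specialize (HN m n Hm Hn).
  apply Rle_lt_trans with (eps / (ns_norm x + 1) * ns_norm x);
    [apply Rmult_le_compat_r; lra|].
  apply (Rmult_lt_reg_r (ns_norm x + 1)); [lra|].
  replace (eps / (ns_norm x + 1) * ns_norm x * (ns_norm x + 1))
    with (eps * ns_norm x) by (field; lra).
  nra. }
destruct (functional_choice _ Hc) as [l Hl].
assert (Hlim : forall eps, 0 < eps -> exists N, forall n, (N <= n)%nat ->
    forall x, Rabs (dfun (u n) x - l x) <= eps * ns_norm x).
{ intros eps Heps. destruct (Hu eps Heps) as [N HN].
  exists N; intros n Hn x. apply le_epsilon; intros d Hdd.
  (* [N'] depends on [x] but only serves the intermediate index [max N N']; the final [N] does not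
     depend on [x]. *)
  destruct (Hl x d Hdd) as [N' HN'].
  specialize (HN' (max N N') (Nat.le_max_r _ _)). unfold R_dist in HN'.
  specialize (HN n (max N N') Hn (Nat.le_max_l _ _)).
  specialize (Hd n (max N N') x).
  replace (dfun (u n) x - l x) with ((dfun (u n) x - dfun (u (max N N')) x)
    + (dfun (u (max N N')) x - l x)) by ring.
  eapply Rle_trans; [apply Rabs_triang|].
  pose proof (ns_norm_nonneg X x). nra. }
assert (Hlin : is_linear l).
{ split.
  - intros x y. apply (UL_sequence (fun n => dfun (u n) (ns_add x y))); [apply Hl|].
    eapply Un_cv_ext; [|apply (CV_plus _ _ _ _ (Hl x) (Hl y))].
    intro n; simpl; now rewrite (proj1 (dfun_lin _ (u n))).
  - intros a x. apply (UL_sequence (fun n => dfun (u n) (ns_scal a x))); [apply Hl|].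
    assert (Ha : Un_cv (fun _ => a) a)
      by (intros eps Heps; exists 0%nat; intros; now rewrite Rdist_eq).
    eapply Un_cv_ext; [|apply (CV_mult _ _ _ _ Ha (Hl x))].
    intro n; simpl; now rewrite (proj2 (dfun_lin _ (u n))). }
assert (Hbdd : exists K, bounded_by l K).
{ destruct (Hlim 1 Rlt_0_1) as [N HN]. specialize (HN N (le_n _)).
  exists (1 + dual_norm (u N)); intro x. specialize (HN x).
  pose proof (dual_norm_bounded X (u N) x).
  replace (l x) with (dfun (u N) x - (dfun (u N) x - l x)) by ring.
  eapply Rle_trans; [apply Rabs_triang|]. rewrite Rabs_Ropp. lra. }
exists (mkDual X l Hlin Hbdd).
intros eps Heps. destruct (Hlim (eps / 2)) as [N HN]; [lra|].
exists N; intros n Hn.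
apply Rle_lt_trans with (eps / 2); [|lra].
apply dual_norm_le; [lra|].
intro x; simpl.
replace (dfun (u n) x + -1 * l x) with (dfun (u n) x - l x) by ring.
now apply HN.
Qed.

(** * Products *)

Definition prodNS (X Y : NormedSpace) : NormedSpace.
Proof.
refine {| ns_car := (X * Y)%type; ns_zero := (ns_zero, ns_zero);
  ns_add := fun u v => (ns_add (fst u) (fst v), ns_add (snd u) (snd v));
  ns_opp := fun u => (ns_opp (fst u), ns_opp (snd u));
  ns_scal := fun a u => (ns_scal a (fst u), ns_scal a (snd u));
  ns_norm := fun u => ns_norm (fst u) + ns_norm (snd u) |}.
- intros; simpl; f_equal; apply ns_add_assoc.
- intros; simpl; f_equal; apply ns_add_comm.
- intros [? ?]; simpl; f_equal; apply ns_add_zero.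
- intros; simpl; f_equal; apply ns_add_opp.
- intros; simpl; f_equal; apply ns_scal_assoc.
- intros [? ?]; simpl; f_equal; apply ns_scal_one.
- intros; simpl; f_equal; apply ns_scal_distr_l.
- intros; simpl; f_equal; apply ns_scal_distr_r.
- intros [x y]; simpl.
  pose proof (ns_norm_nonneg X x); pose proof (ns_norm_nonneg Y y); lra.
- intros [x y]; simpl; intro H.
  pose proof (ns_norm_nonneg X x); pose proof (ns_norm_nonneg Y y).
  f_equal; apply ns_norm_eq0; lra.
- intros; simpl; rewrite !ns_norm_scal; ring.
- intros [x y] [x' y']; simpl.
  pose proof (ns_norm_triangle X x x'); pose proof (ns_norm_triangle Y y y'); lra.
Defined.

Lemma prod_complete (X Y : NormedSpace) :
  complete X -> complete Y -> complete (prodNS X Y).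
Proof.
intros HX HY u Hu.
destruct (HX (fun n => fst (u n))) as [l Hl].
{ intros eps Heps. destruct (Hu eps Heps) as [N HN].
  exists N; intros m n Hm Hn. specialize (HN m n Hm Hn); simpl in HN.
  pose proof (ns_norm_nonneg Y (ns_sub (snd (u m)) (snd (u n)))).
  unfold ns_sub in *; simpl in *; lra. }
destruct (HY (fun n => snd (u n))) as [k Hk].
{ intros eps Heps. destruct (Hu eps Heps) as [N HN].
  exists N; intros m n Hm Hn. specialize (HN m n Hm Hn); simpl in HN.
  pose proof (ns_norm_nonneg X (ns_sub (fst (u m)) (fst (u n)))).
  unfold ns_sub in *; simpl in *; lra. }
exists (l, k). intros eps Heps.
destruct (Hl (eps / 2)) as [N HN]; [lra|].
destruct (Hk (eps / 2)) as [N' HN']; [lra|].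
exists (max N N'); intros n Hn.
specialize (HN n ltac:(lia)). specialize (HN' n ltac:(lia)).
unfold ns_sub in *; simpl in *; lra.
Qed.

(** * Hahn-Banach *)

(** Zorn's lemma for inclusion. The chain [G] may be empty, so the premise includes [P] for the
    empty set. *)
Lemma maximal_of_chain_union (T : Type) (P : (T -> Prop) -> Prop) :
  (forall G : (T -> Prop) -> Prop, (forall S, G S -> P S) ->
    (forall S S', G S -> G S' -> (forall x, S x -> S' x) \/ (forall x, S' x -> S x)) ->
    P (fun x => exists2 S, G S & S x)) ->
  exists M, P M /\ forall S, P S -> (forall x, M x -> S x) -> forall x, S x -> M x.
Proof.
intro H.
destruct (@classical_sets.Zorn_bigcup T P) as (M & HM & Hmax).
- intros G HG Htot. apply H; [exact HG|exact Htot].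
- exists M; split; [exact HM|].
  intros S HS HMS. apply NNPP; intro Hn.
  apply (Hmax S); [split; assumption|assumption].
Qed.

(** A convex cone with no point strictly below the origin. A member [(v, r)] is read as the
    constraint that the sought functional is at most [r] at [v]. *)
Definition admissible_cone {X : NormedSpace} (C : X * R -> Prop) : Prop :=
  (forall u r v s, C (u, r) -> C (v, s) -> C (ns_add u v, r + s)) /\
  (forall t u r, 0 <= t -> C (u, r) -> C (ns_scal t u, t * r)) /\
  (forall r, C (ns_zero, r) -> 0 <= r).

Lemma maximal_admissible_cone (X : NormedSpace) (C0 : X * R -> Prop) :
  admissible_cone C0 ->
  exists C, admissible_cone C /\ (forall w, C0 w -> C w) /\
    forall D, admissible_cone D -> (forall w, C w -> D w) -> forall w, D w -> C w.
Proof.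
intro H0.
(* Zorn is applied to the part added to [C0]: the empty chain then yields [C0] itself, and the
   maximal cone contains [C0]. *)
destruct (maximal_of_chain_union (X * R)
  (fun S => admissible_cone (fun w => C0 w \/ S w))) as (M & HM & Hmax).
- intros G HG Htot.
  split; [|split].
  + intros u r v s [Hu|[S HS Hu]] [Hv|[S' HS' Hv]].
    * left; now apply H0.
    * destruct (proj1 (HG _ HS') u r v s) as [?|?]; [now left|now right|now left|].
      right; now exists S'.
    * destruct (proj1 (HG _ HS) u r v s) as [?|?]; [now right|now left|now left|].
      right; now exists S.
    * destruct (Htot S S' HS HS') as [Hi|Hi].
      -- destruct (proj1 (HG _ HS') u r v s) as [?|?];
           [right; now apply Hi|now right|now left|].
         right; now exists S'.
      -- destruct (proj1 (HG _ HS) u r v s) as [?|?];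
           [now right|right; now apply Hi|now left|].
         right; now exists S.
  + intros t u r Ht [Hu|[S HS Hu]].
    * left; now apply H0.
    * destruct (proj1 (proj2 (HG _ HS)) t u r) as [?|?];
        [assumption|now right|now left|].
      right; now exists S.
  + intros r [Hr|[S HS Hr]].
    * now apply H0.
    * apply (proj2 (proj2 (HG _ HS))); now right.
- exists (fun w => C0 w \/ M w).
  split; [exact HM|]. split; [now left|].
  intros D HD HCD w Dw. right.
  apply (Hmax D); [|auto|assumption].
  assert (HE : forall w, C0 w \/ D w -> D w) by (intros ? [?|?]; auto).
  destruct HD as (Da & Ds & Dz).
  split; [|split].
  + intros u r v s Hu Hv; right; apply Da; now apply HE.
  + intros t u r Ht Hu; right; apply Ds; auto.
  + intros r Hr; apply Dz; now apply HE.
Qed.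

(** Adjoin the ray through [(v, s)]. If the larger cone [D] is admissible, maximality puts [(v, s)]
    in [C]. Otherwise [D] has a point below the origin, and solving for the summand in [C] gives a
    point over [ns_opp v] of height less than [- s]. *)
Lemma maximal_cone_halfspace (X : NormedSpace) (C : X * R -> Prop) :
  admissible_cone C ->
  (forall D, admissible_cone D -> (forall w, C w -> D w) -> forall w, D w -> C w) ->
  (forall r, 0 <= r -> C (ns_zero, r)) ->
  forall v s, C (v, s) \/ C (ns_opp v, - s).
Proof.
intros HC Hmax Hup v s.
destruct (classic (C (v, s))) as [Hv|Hv]; [now left|right].
pose (D := fun w : X * R => exists c rho t, 0 <= t /\ C (c, rho) /\
  fst w = ns_add c (ns_scal t v) /\ snd w = rho + t * s).
destruct HC as (Ca & Cs & Cz).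
destruct (classic (forall r, D (ns_zero, r) -> 0 <= r)) as [HD|HD].
- exfalso; apply Hv, (Hmax D).
  + split; [|split; [|exact HD]].
    * intros u r u' r' (c & rho & t & Ht & Hc & E1 & E2)
        (c' & rho' & t' & Ht' & Hc' & E1' & E2'); simpl in *; subst.
      exists (ns_add c c'), (rho + rho'), (t + t'); simpl.
      split; [lra|]. split; [now apply Ca|].
      split; [|ring]. rewrite ns_scal_distr_r. apply add_shuffle.
    * intros a u r Ha (c & rho & t & Ht & Hc & E1 & E2); simpl in *; subst.
      exists (ns_scal a c), (a * rho), (a * t); simpl.
      split; [now apply Rmult_le_pos|]. split; [now apply Cs|].
      split; [|ring]. now rewrite ns_scal_distr_l, ns_scal_assoc.
  + intros [c rho] Hc. exists c, rho, 0; simpl.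
    rewrite scal_zero, ns_add_zero.
    split; [lra|]. split; [assumption|]. split; [reflexivity|ring].
  + exists ns_zero, 0, 1; simpl. rewrite ns_scal_one, add_zero_l.
    split; [lra|]. split; [apply Hup; lra|]. split; [reflexivity|ring].
- apply not_all_ex_not in HD as [r HD].
  apply imply_to_and in HD as [(c & rho & t & Ht & Hc & E1 & E2) Hr].
  simpl in *; subst r.
  destruct Ht as [Ht|<-].
  + symmetry in E1; apply add_eq_zero in E1; subst c.
    apply (Cs (/ t)) in Hc; [|now apply Rlt_le, Rinv_0_lt_compat].
    replace (ns_scal (/ t) (ns_opp (ns_scal t v))) with (ns_opp v) in Hc.
    (* The vertical gap between the height [/ t * rho] reached in [C] and the wanted height
       [- s]. *)
    * assert (Hp : 0 <= - ((rho + t * s) / t)).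
      { apply Ropp_0_ge_le_contravar, Rle_ge.
        apply (Rmult_le_reg_r t); [assumption|].
        replace ((rho + t * s) / t * t) with (rho + t * s) by (field; lra). lra. }
      pose proof (Ca _ _ _ _ Hc (Hup _ Hp)) as H.
      rewrite ns_add_zero in H.
      now replace (- s) with (/ t * rho + - ((rho + t * s) / t)) by (field; lra).
    * rewrite !opp_scal, !ns_scal_assoc. f_equal; field; lra.
  + exfalso. rewrite scal_zero, ns_add_zero in E1; subst c.
    apply Cz in Hc; lra.
Qed.

(** A relation instead of a function allows the value plus infinity, as a point with no [r] above
    it. *)
Definition convex_epi {X : NormedSpace} (E : X -> R -> Prop) : Prop :=
  forall t u r v s, 0 <= t <= 1 -> E u r -> E v s ->
    E (ns_add (ns_scal t u) (ns_scal (1 - t) v)) (t * r + (1 - t) * s).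

(** This is the upward closed cone generated by [E]. A sum of multiples [t] and [t'] is [t + t']
    times a convex combination with weight [t / (t + t')], whence the separate case [t + t' = 0]. *)
Lemma admissible_cone_of_convex (X : NormedSpace) (E : X -> R -> Prop) :
  convex_epi E -> (forall r, E ns_zero r -> 0 <= r) ->
  admissible_cone (fun w => exists t v r, 0 <= t /\ E v r /\
    fst w = ns_scal t v /\ t * r <= snd w).
Proof.
intros HE HE0.
split; [|split]; simpl.
- intros u r u' r' (t & v & s & Ht & Hv & -> & Hr) (t' & v' & s' & Ht' & Hv' & -> & Hr').
  destruct (Req_dec (t + t') 0) as [Hs|Hs].
  + assert (t = 0) by lra; assert (t' = 0) by lra; subst t t'.
    exists 0, v, s. rewrite !scal_zero, ns_add_zero.
    split; [lra|]. split; [assumption|]. split; [reflexivity|lra].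
  + exists (t + t'), (ns_add (ns_scal (t / (t + t')) v) (ns_scal (1 - t / (t + t')) v')),
      (t / (t + t') * s + (1 - t / (t + t')) * s').
    split; [lra|]. split; [|split].
    * apply HE; [|assumption|assumption].
      split; apply (Rmult_le_reg_r (t + t')); try lra;
        replace (t / (t + t') * (t + t')) with t by (field; lra); lra.
    * rewrite ns_scal_distr_l, !ns_scal_assoc. f_equal; f_equal; field; lra.
    * replace ((t + t') * (t / (t + t') * s + (1 - t / (t + t')) * s'))
        with (t * s + t' * s') by (field; lra). lra.
- intros a u r Ha (t & v & s & Ht & Hv & -> & Hr).
  exists (a * t), v, s.
  split; [now apply Rmult_le_pos|]. split; [assumption|].
  split; [apply ns_scal_assoc|]. rewrite Rmult_assoc. now apply Rmult_le_compat_l.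
- intros r (t & v & s & [Ht|<-] & Hv & E1 & Hr).
  + assert (v = ns_zero) as ->.
    { rewrite <- (ns_scal_one _ v), <- (Rinv_l t), <- ns_scal_assoc, <- E1 by lra.
      apply scal_vzero. }
    apply HE0 in Hv. nra.
  + lra.
Qed.

(* The functional is the lower boundary of a maximal cone containing the epigraph; by
   maximality such a cone is a half-space. *)
Lemma linear_minorant_at_zero (X : NormedSpace) (E : X -> R -> Prop) :
  convex_epi E -> (forall v, exists r, E v r) -> (forall r, E ns_zero r -> 0 <= r) ->
  exists L : X -> R, is_linear L /\ forall v r, E v r -> L v <= r.
Proof.
intros HE Htot HE0.
destruct (maximal_admissible_cone X _ (admissible_cone_of_convex X E HE HE0))
  as (C & HC & HEC & Hmax).
assert (HEC' : forall v r, E v r -> C (v, r)).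
{ intros v r Hv; apply HEC; exists 1, v, r; simpl.
  rewrite ns_scal_one. repeat split; (assumption || lra). }
assert (Hup : forall r, 0 <= r -> C (ns_zero, r)).
{ intros r Hr. destruct (Htot ns_zero) as [s Hs].
  apply HEC; exists 0, ns_zero, s; simpl.
  rewrite scal_zero. repeat split; (assumption || lra). }
pose proof (maximal_cone_halfspace X C HC Hmax Hup) as Hhalf.
destruct HC as (Ca & Cs & Cz).
assert (Hinf : forall v, exists l, (forall r, C (v, r) -> l <= r) /\
  forall m, (forall r, C (v, r) -> m <= r) -> m <= l).
{ intro v.
  destruct (completeness (fun q => C (v, - q))) as [m [ub lub]].
  - destruct (Htot (ns_opp v)) as [s Hs]. apply HEC' in Hs.
    exists s; intros q Hq. pose proof (Ca _ _ _ _ Hq Hs) as H.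
    rewrite ns_add_opp in H. apply Cz in H; lra.
  - destruct (Htot v) as [r Hr]. exists (- r). rewrite Ropp_involutive; auto.
  - exists (- m); split.
    + intros r Hr. enough (- r <= m) by lra. apply ub. now rewrite Ropp_involutive.
    + intros k Hk. enough (m <= - k) by lra. apply lub.
      intros q Hq. apply Hk in Hq; lra. }
destruct (functional_choice _ Hinf) as [L HL].
assert (Hsub : forall u v, L (ns_add u v) <= L u + L v).
{ intros u v. enough (L (ns_add u v) - L v <= L u) by lra.
  apply HL; intros r Hr. enough (L (ns_add u v) - r <= L v) by lra.
  apply HL; intros s Hs. enough (L (ns_add u v) <= r + s) by lra.
  apply HL; now apply Ca. }
assert (Hopp : forall v, L (ns_opp v) = - L v).
{ intro v; apply Rle_antisym.
  (* [(v, L v - eps)] lies below the infimum, hence outside [C]; the half-space property then puts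
     its opposite in [C]. *)
  - apply le_epsilon; intros eps Heps.
    destruct (Hhalf v (L v - eps)) as [H|H]; apply HL in H; lra.
  - apply HL; intros s Hs. enough (- s <= L v) by lra.
    apply HL; intros r Hr. pose proof (Ca _ _ _ _ Hr Hs) as H.
    rewrite ns_add_opp in H; apply Cz in H; lra. }
assert (Hpos : forall t v, 0 < t -> t * L v <= L (ns_scal t v)).
{ intros t v Ht. apply HL; intros r Hr.
  apply (Cs (/ t)) in Hr; [|now apply Rlt_le, Rinv_0_lt_compat].
  rewrite ns_scal_assoc, Rinv_l, ns_scal_one in Hr by lra.
  apply HL in Hr. apply (Rmult_le_compat_l t) in Hr; [|lra].
  now rewrite <- Rmult_assoc, Rinv_r, Rmult_1_l in Hr by lra. }
assert (Hpos' : forall t v, 0 < t -> L (ns_scal t v) = t * L v).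
{ intros t v Ht; apply Rle_antisym; [|now apply Hpos].
  pose proof (Hpos t (ns_opp v) Ht) as H.
  replace (ns_scal t (ns_opp v)) with (ns_opp (ns_scal t v)) in H
    by (rewrite !opp_scal, !ns_scal_assoc; f_equal; ring).
  rewrite !Hopp in H; lra. }
exists L; split; [split|].
- intros u v; apply Rle_antisym; [apply Hsub|].
  pose proof (Hsub (ns_opp u) (ns_opp v)) as H.
  replace (ns_add (ns_opp u) (ns_opp v)) with (ns_opp (ns_add u v)) in H
    by (rewrite !opp_scal; apply ns_scal_distr_l).
  rewrite !Hopp in H; lra.
- intros a v. destruct (Rtotal_order a 0) as [Ha|[->|Ha]].
  + replace (ns_scal a v) with (ns_opp (ns_scal (- a) v))
      by (rewrite opp_scal, ns_scal_assoc; f_equal; ring).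
    rewrite Hopp, Hpos' by lra; ring.
  (* [ns_scal 0 v] is its own opposite, so oddness makes [L] vanish there. *)
  + pose proof (Hopp (ns_scal 0 v)) as H.
    rewrite opp_scal, ns_scal_assoc in H.
    replace (-1 * 0) with 0 in H by ring. lra.
  + now apply Hpos'.
- intros v r Hv; apply HL; auto.
Qed.

(** * Local boundedness and continuity *)

Lemma halving_pow (r : nat -> R) (r0 : R) :
  0 < r0 -> r 0%nat <= r0 -> (forall n, r (S n) <= r n / 2) ->
  forall eps, 0 < eps -> exists N, r N < eps.
Proof.
intros Hr0 H0 HS eps Heps.
assert (H : forall n, r n <= r0 * (/ 2) ^ n).
{ induction n as [|n IH]; simpl; [lra|]. specialize (HS n). lra. }
destruct (pow_lt_1_zero (/ 2) ltac:(rewrite Rabs_pos_eq; lra) (eps / r0)) as [N HN].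
{ now apply Rdiv_lt_0_compat. }
exists N. specialize (HN N (le_n _)).
rewrite Rabs_pos_eq in HN by (apply pow_le; lra).
apply (Rmult_lt_compat_l r0) in HN; [|assumption].
replace (r0 * (eps / r0)) with eps in HN by (field; lra).
specialize (H N); lra.
Qed.

(** A move of at most [r n / 2] is at most [r n - r (S n)], so the distances between centers
    telescope: the centers are Cauchy and from index [n] on stay within [r n] of [c n]. *)
Lemma nested_balls (X : NormedSpace) (c : nat -> X) (r : nat -> R) :
  complete X -> (forall n, 0 < r n) -> (forall n, r (S n) <= r n / 2) ->
  (forall n, ns_norm (ns_sub (c (S n)) (c n)) <= r n / 2) ->
  exists l, forall n, ns_norm (ns_sub l (c n)) <= r n.
Proof.
intros HX Hr Hr2 Hc.
assert (Hk : forall n k, ns_norm (ns_sub (c (n + k)%nat) (c n)) <= r n - r (n + k)%nat).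
{ intros n k; induction k as [|k IH].
  - rewrite Nat.add_0_r, norm_sub_self; lra.
  - rewrite Nat.add_succ_r.
    pose proof (norm_sub_triangle X (c (S (n + k))) (c (n + k)%nat) (c n)).
    specialize (Hr2 (n + k)%nat). specialize (Hc (n + k)%nat). lra. }
assert (Hmn : forall n m, (n <= m)%nat -> ns_norm (ns_sub (c m) (c n)) <= r n).
{ intros n m Hm. replace m with (n + (m - n))%nat by lia.
  specialize (Hk n (m - n)%nat). specialize (Hr (n + (m - n))%nat). lra. }
destruct (HX c) as [l Hl].
- intros eps Heps.
  destruct (halving_pow r (r 0%nat) (Hr 0%nat) (Rle_refl _) Hr2 (eps / 2)) as [N HN];
    [lra|].
  exists N; intros m n Hm Hn.
  pose proof (norm_sub_triangle X (c m) (c N) (c n)).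
  rewrite (norm_sub_sym X (c N) (c n)) in H.
  pose proof (Hmn N m Hm). pose proof (Hmn N n Hn). lra.
- exists l; intro n. apply le_epsilon; intros eps Heps.
  destruct (Hl eps Heps) as [N HN].
  specialize (HN (max n N) (Nat.le_max_r _ _)).
  rewrite norm_sub_sym in HN.
  pose proof (Hmn n (max n N) (Nat.le_max_l _ _)).
  pose proof (norm_sub_triangle X l (c (max n N)) (c n)). lra.
Qed.

(** A Baire argument as for uniform boundedness: if no ball works, nested balls can be chosen on
    which ever larger values are forced, and their common point violates the pointwise bound. *)
Lemma pointwise_bounded_locally_bounded (X : NormedSpace) (I : Type) (h : I -> X -> R) :
  complete X ->
  (forall i, exists K, forall u v, h i u - h i v <= K * ns_norm (ns_sub u v)) ->
  (forall u, exists M, forall i, h i u <= M) ->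
  exists u0 rho M, 0 < rho /\
    forall u, ns_norm (ns_sub u u0) <= rho -> forall i, h i u <= M.
Proof.
intros HX Hlip Hfin. apply NNPP; intro Hn.
(* A ball is a pair (center, radius); the k-th ball forces some [h i] above [k]. *)
pose (step := fun (k : nat) (b b' : X * R) => 0 < snd b ->
  0 < snd b' /\ snd b' <= snd b / 2 /\
  ns_norm (ns_sub (fst b') (fst b)) <= snd b / 2 /\
  exists i, forall u, ns_norm (ns_sub u (fst b')) <= snd b' -> INR k < h i u).
assert (Hstep : forall kb, exists b', step (fst kb) (snd kb) b').
{ intros [k [c r]]; unfold step; simpl.
  (* For a nonpositive radius [step] is vacuous, and the pair itself is a default value. *)
  destruct (classic (0 < r)) as [Hr|Hr]; [|exists (c, r); intro; contradiction].
  destruct (classic (forall u, ns_norm (ns_sub u c) <= r / 2 ->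
    forall i, h i u <= INR k + 1)) as [H|H].
  { exfalso; apply Hn; exists c, (r / 2), (INR k + 1); split; [lra|assumption]. }
  apply not_all_ex_not in H as [u H].
  apply imply_to_and in H as [Hu H].
  apply not_all_ex_not in H as [i Hi]. apply Rnot_le_lt in Hi.
  destruct (Hlip i) as [K HK].
  pose proof (Rle_abs K) as HKa. pose proof (Rabs_pos K).
  assert (Hd : 0 < / (Rabs K + 1)) by (apply Rinv_0_lt_compat; lra).
  (* Within this radius [h i] drops by at most 1 from its value at [u], which exceeds
     [INR k + 1]. *)
  exists (u, Rmin (r / 2) (/ (Rabs K + 1))); simpl; intros _.
  split; [apply Rmin_glb_lt; lra|]. split; [apply Rmin_l|]. split; [assumption|].
  exists i; intros v Hv.
  pose proof (Rmin_r (r / 2) (/ (Rabs K + 1))).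
  specialize (HK u v). rewrite norm_sub_sym in HK.
  pose proof (ns_norm_nonneg X (ns_sub v u)).
  assert ((Rabs K + 1) * ns_norm (ns_sub v u) <= 1).
  { rewrite Rmult_comm. apply (Rmult_le_reg_r (/ (Rabs K + 1))); [assumption|].
    rewrite Rmult_assoc, Rinv_r; lra. }
  nra. }
destruct (functional_choice _ Hstep) as [f Hf].
pose (b := fix b k := match k with O => (ns_zero, 1) | S k => f (k, b k) end).
assert (Hpos : forall k, 0 < snd (b k)).
{ induction k as [|k IH]; simpl; [lra|]. now apply (Hf (k, b k)). }
destruct (nested_balls X (fun k => fst (b k)) (fun k => snd (b k)) HX Hpos) as [l Hl].
- intro k. now apply (Hf (k, b k)), Hpos.
- intro k. now apply (Hf (k, b k)), Hpos.
- destruct (Hfin l) as [M HM].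
  destruct (INR_unbounded M) as [k Hk].
  destruct (Hf (k, b k) (Hpos k)) as (_ & _ & _ & i & Hi).
  (* The ball that forces a value above [k] is the one produced from [b k], that is [b (S k)]. *)
  specialize (Hi l (Hl (S k))). specialize (HM i). simpl in Hi. lra.
Qed.

(** Translating the ball to the origin costs [L u0]; symmetry of the centered ball turns the upper
    bound into one on [Rabs (L v)], and rescaling to norm [rho] gives the constant. *)
Lemma linear_bounded_of_ball (X : NormedSpace) (L : X -> R) (u0 : X) (rho K : R) :
  is_linear L -> 0 < rho ->
  (forall u, ns_norm (ns_sub u u0) <= rho -> L u <= K) ->
  exists M, bounded_by L M.
Proof.
intros HL Hrho HK.
assert (Hb : forall v, ns_norm v <= rho -> L v <= K - L u0).
{ intros v Hv. specialize (HK (ns_add u0 v)). rewrite add_sub, (proj1 HL) in HK.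
  specialize (HK Hv); lra. }
assert (Hb' : forall v, ns_norm v <= rho -> Rabs (L v) <= K - L u0).
{ intros v Hv. apply Rabs_le. pose proof (Hb v Hv).
  specialize (Hb (ns_opp v)). rewrite norm_opp, linear_opp in Hb by assumption.
  specialize (Hb Hv). lra. }
exists ((K - L u0) / rho); intro v.
destruct (ns_norm_nonneg X v) as [Hv|Hv].
- specialize (Hb' (ns_scal (rho / ns_norm v) v)).
  assert (Hp : 0 < rho / ns_norm v) by now apply Rdiv_lt_0_compat.
  rewrite ns_norm_scal, (proj2 HL), Rabs_mult, (Rabs_pos_eq (rho / ns_norm v)) in Hb'
    by lra.
  replace (rho / ns_norm v * ns_norm v) with rho in Hb' by (field; lra).
  specialize (Hb' (Rle_refl _)).
  apply (Rmult_le_reg_l (rho / ns_norm v)); [assumption|].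
  replace (rho / ns_norm v * ((K - L u0) / rho * ns_norm v)) with (K - L u0)
    by (field; lra).
  assumption.
- symmetry in Hv; rewrite Hv. apply ns_norm_eq0 in Hv; subst v.
  rewrite linear_zero, Rabs_R0 by assumption; lra.
Qed.

(** * Fenchel duality *)

(* [f] and [g] stand for the epigraphs of two convex functions; the functional is a
   subgradient at 0 of their infimal convolution. *)
Lemma fenchel_duality (X : NormedSpace) (f g : X -> R -> Prop) (u0 : X) (rho M : R) :
  convex_epi f -> convex_epi g ->
  (exists w r, f w r) -> (forall u, exists s, g u s) ->
  0 < rho -> (forall u, ns_norm (ns_sub u u0) <= rho -> g u M) ->
  (forall w r s, f w r -> g (ns_opp w) s -> 0 <= r + s) ->
  exists (L : dual X) (c : R),
    (forall w r, f w r -> L w + c <= r) /\ (forall u s, g u s -> L u - c <= s).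
Proof.
intros Hf Hg (w0 & r0 & Hw0) Hgtot Hrho HM Hfg.
destruct (linear_minorant_at_zero X
  (fun v q => exists w r u s, f w r /\ g u s /\ v = ns_add w u /\ q = r + s))
  as (L & HL & HLfg).
- intros t v q v' q' Ht (w & r & u & s & Hw & Hu & -> & ->)
    (w' & r' & u' & s' & Hw' & Hu' & -> & ->).
  exists (ns_add (ns_scal t w) (ns_scal (1 - t) w')), (t * r + (1 - t) * r'),
    (ns_add (ns_scal t u) (ns_scal (1 - t) u')), (t * s + (1 - t) * s').
  split; [now apply Hf|]. split; [now apply Hg|]. split; [|ring].
  rewrite !ns_scal_distr_l. apply add_shuffle.
- intro v. destruct (Hgtot (ns_sub v w0)) as [s Hs].
  exists (r0 + s), w0, r0, (ns_sub v w0), s.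
  repeat split; try assumption.
  unfold ns_sub. rewrite ns_add_comm, <- ns_add_assoc, (ns_add_comm _ (ns_opp w0)).
  now rewrite ns_add_opp, ns_add_zero.
- intros q (w & r & u & s & Hw & Hu & E & ->).
  symmetry in E; rewrite ns_add_comm in E; apply add_eq_zero in E; subst u.
  now apply (Hfg w).
- assert (H : forall w r u s, f w r -> g u s -> L w + L u <= r + s).
  { intros w r u s Hw Hu. rewrite <- (proj1 HL). apply HLfg.
    now exists w, r, u, s. }
  assert (Hbd : exists K, bounded_by L K).
  { apply (linear_bounded_of_ball X L u0 rho (r0 + M - L w0)); [assumption..|].
    intros u Hu. specialize (H w0 r0 u M Hw0 (HM u Hu)). lra. }
  (* [c] is the convex conjugate of [g] at [L], finite because a point of [f] bounds it. *)
  destruct (completeness (fun q => exists u s, g u s /\ q = L u - s)) as [c [ub lub]].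
  + exists (r0 - L w0); intros q (u & s & Hu & ->).
    specialize (H w0 r0 u s Hw0 Hu). lra.
  + destruct (Hgtot u0) as [s Hs]. now exists (L u0 - s), u0, s.
  + exists (mkDual X L HL Hbd), c; simpl; split.
    * intros w r Hw. enough (c <= r - L w) by lra. apply lub.
      intros q (u & s & Hu & ->). specialize (H w r u s Hw Hu). lra.
    * intros u s Hu. enough (L u - s <= c) by lra. apply ub. now exists u, s.
Qed.

(** [L] is the sum of its restrictions to the two factors; the restriction to the dual factor is
    evaluation at a point by reflexivity. *)
Lemma dual_prod_repr (X : NormedSpace) (L : dual (prodNS X (dualNS X))) :
  reflexive X ->
  exists (z : X) (zs : dual X), forall x (xs : dual X), L (x, xs) = zs x + xs z.
Proof.
intro HX. destruct L as [L HL [K HK]]; simpl.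
assert (Hl1 : is_linear (fun x : X => L (x, ns_zero))).
{ split.
  - intros x y. rewrite <- (proj1 HL). simpl. f_equal; f_equal.
    symmetry; apply (ns_add_zero (dualNS X)).
  - intros a x. rewrite <- (proj2 HL). simpl. f_equal; f_equal.
    symmetry; apply (scal_vzero (dualNS X)). }
assert (Hb1 : exists K, bounded_by (fun x : X => L (x, ns_zero)) K).
{ exists K; intro x. eapply Rle_trans; [apply HK|]. simpl.
  pose proof (norm_zero (dualNS X)) as H0; simpl in H0. rewrite H0; lra. }
destruct (HX (fun xs : dual X => L (ns_zero, xs))) as [z Hz].
- intros f g h Hh.
  replace h with (dual_add f g) by (apply dual_ext; intro; symmetry; apply Hh).
  rewrite <- (proj1 HL). simpl. f_equal; f_equal. symmetry; apply ns_add_zero.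
- intros a f g Hg.
  replace g with (dual_scal a f) by (apply dual_ext; intro; symmetry; apply Hg).
  rewrite <- (proj2 HL). simpl. f_equal; f_equal. symmetry; apply scal_vzero.
- exists (Rabs K); intros f k Hk Hf.
  eapply Rle_trans; [apply HK|]. simpl. rewrite norm_zero, Rplus_0_l.
  eapply Rle_trans; [apply Rmult_le_compat_r; [apply dual_norm_ge0|apply Rle_abs]|].
  apply Rmult_le_compat_l; [apply Rabs_pos|]. now apply dual_norm_le.
- exists z, (mkDual X _ Hl1 Hb1); intros x xs; simpl.
  rewrite <- Hz, <- (proj1 HL). simpl. f_equal; f_equal.
  + symmetry; apply ns_add_zero.
  + symmetry; apply (add_zero_l (dualNS X)).
Qed.

(** * Maximal monotone operators and Fitzpatrick functions *)

(** The epigraph of a supremum of affine functions, the form of both Fitzpatrick functions below. *)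
Lemma convex_epi_sup (X : NormedSpace) (I : Type) (P : I -> Prop) (h : I -> X -> R)
  (c : I -> R) :
  (forall i, is_linear (h i)) ->
  convex_epi (fun u s => forall i, P i -> h i u - c i <= s).
Proof.
intros Hh t u r v s Ht Hu Hv i Pi.
rewrite (proj1 (Hh i)), !(proj2 (Hh i)).
specialize (Hu i Pi). specialize (Hv i Pi).
apply (Rmult_le_compat_l t) in Hu; [|lra].
apply (Rmult_le_compat_l (1 - t)) in Hv; lra.
Qed.

(** Adding the single pair [(z, zs)] to the graph keeps it monotone. *)
Lemma maximal_monotone_mem (X : NormedSpace) (A : setop X) (z : X) (zs : dual X) :
  maximal_monotone A ->
  (forall y ys, A y ys -> 0 <= pairing (ns_sub z y) zs - pairing (ns_sub z y) ys) ->
  A z zs.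
Proof.
intros [HA HAmax] Hz.
apply (HAmax (fun x xs => A x xs \/ (x = z /\ xs = zs))); [|now left|now right].
intros x xs y ys [Hx|[-> ->]] [Hy|[-> ->]].
- now apply HA.
- specialize (Hz _ _ Hx). unfold pairing in *.
  rewrite !linear_sub in * by apply dfun_lin. lra.
- now apply Hz.
- lra.
Qed.

(** Every pair is vacuously monotonically related to an empty graph. This gives a point where the
    Fitzpatrick function of [A] is finite. *)
Lemma maximal_monotone_nonempty (X : NormedSpace) (A : setop X) :
  maximal_monotone A -> exists z zs, A z zs.
Proof.
intro HA. apply NNPP; intro Hn. apply Hn.
exists ns_zero, dual_zero. apply maximal_monotone_mem; [assumption|].
intros y ys Hy; exfalso; apply Hn; now exists y, ys.
Qed.

(* Fenchel duality for the Fitzpatrick functions of [A] (epigraph [f]) and of [G]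
   (epigraph [g], with the sign of the first variable changed), the latter being finite
   everywhere because [G] is 3*-monotone. *)
Lemma three_star_sum_zero (X : NormedSpace) (A : setop X) (G : X -> dual X) :
  reflexive_Banach X -> maximal_monotone A ->
  monotone (graph_of G) -> three_star_monotone G ->
  exists (z : X) (zs : dual X), A z zs /\
    forall y, 0 <= - pairing (ns_sub z y) zs - pairing (ns_sub z y) (G y).
Proof.
intros [HXc HXr] HAm HG HG3.
pose (Z := prodNS X (dualNS X)).
pose (k := fun (p : X * dual X) (w : Z) => snd p (fst w) + dfun (snd w) (fst p)).
pose (h := fun (y : X) (u : Z) => - G y (fst u) + dfun (snd u) y).
pose (f := fun (w : Z) (r : R) =>
  forall p, A (fst p) (snd p) -> k p w - snd p (fst p) <= r).
pose (g := fun (u : Z) (s : R) => forall y, True -> h y u - G y y <= s).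
assert (Hk : forall p, is_linear (k p)).
{ intro p; split; unfold k; simpl; intros.
  - rewrite (proj1 (dfun_lin _ (snd p))); ring.
  - rewrite (proj2 (dfun_lin _ (snd p))); ring. }
assert (Hh : forall y, is_linear (h y)).
{ intro y; split; unfold h; simpl; intros.
  - rewrite (proj1 (dfun_lin _ (G y))); ring.
  - rewrite (proj2 (dfun_lin _ (G y))); ring. }
assert (HAf : forall a (b : dual X), A a b -> f (a, b) (b a)).
{ intros a b Hab [a' b'] Hab'; unfold k; simpl in *.
  pose proof (proj1 HAm _ _ _ _ Hab Hab') as H; unfold pairing in H.
  rewrite !linear_sub in H by apply dfun_lin. lra. }
assert (HGg : forall y, g (ns_opp y, G y) (G y y)).
{ intros y y' _; unfold h; simpl.
  rewrite linear_opp by apply dfun_lin.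
  pose proof (HG y (G y) y' (G y') eq_refl eq_refl) as H; unfold pairing in H.
  rewrite !linear_sub in H by apply dfun_lin. lra. }
assert (HfA : forall z (zs : dual X) r, f (z, zs) r -> r <= zs z -> A z zs).
{ intros z zs r Hf Hr. apply maximal_monotone_mem; [assumption|].
  intros y ys Hy. specialize (Hf (y, ys) Hy); unfold k in Hf; simpl in Hf.
  unfold pairing. rewrite !linear_sub by apply dfun_lin. lra. }
assert (Hfge : forall z (zs : dual X) r, f (z, zs) r -> zs z <= r).
(* If [r] were smaller, [HfA] would put [(z, zs)] in [A], and its own term in the supremum equals
   [zs z]. *)
{ intros z zs r Hf. apply Rnot_lt_le; intro Hr.
  assert (HAz : A z zs) by (apply (HfA z zs r); [assumption|lra]).
  specialize (Hf (z, zs) HAz); unfold k in Hf; simpl in Hf. lra. }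
assert (Hgfin : forall u : Z, exists M, forall y, h y u - G y y <= M).
(* The expression bounded by 3*-monotonicity at [(ns_opp x, xs)] differs from the wanted one by the
   constant [xs x]. *)
{ intros [x xs]. destruct (HG3 (ns_opp x) xs) as [M HM].
  exists (M - xs x); intro y; unfold h; simpl. specialize (HM y).
  unfold pairing in HM.
  rewrite !linear_sub, !linear_opp in HM by apply dfun_lin. lra. }
destruct (pointwise_bounded_locally_bounded Z X (fun y u => h y u - G y y))
  as (u0 & rho & M & Hrho & HM).
{ apply prod_complete; [assumption|apply dual_complete]. }
{ intro y. exists (dual_norm (G y) + ns_norm y); intros u v.
  replace (h y u - G y y - (h y v - G y y)) with (h y (ns_sub u v))
    by (rewrite linear_sub by apply Hh; ring).
  generalize (ns_sub u v); intros [x xs]; unfold h; simpl.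
  pose proof (dual_norm_bounded X (G y) x) as H1.
  pose proof (dual_norm_bounded X xs y) as H2.
  pose proof (Rle_abs (- G y x)) as H3; rewrite Rabs_Ropp in H3. pose proof (Rle_abs (xs y)).
  pose proof (dual_norm_ge0 X (G y)). pose proof (dual_norm_ge0 X xs).
  pose proof (ns_norm_nonneg X x). pose proof (ns_norm_nonneg X y). nra. }
{ exact Hgfin. }
destruct (fenchel_duality Z f g u0 rho M) as (L & c & HLf & HLg).
- now apply convex_epi_sup.
- now apply convex_epi_sup.
- destruct (maximal_monotone_nonempty X A HAm) as (a & b & Hab).
  exists (a, b), (b a). now apply HAf.
- intro u. destruct (Hgfin u) as [s Hs]. exists s; now intros y _.
- assumption.
- intros u Hu y _. now apply HM.
(* In the term [y = x] of the supremum the values of [G] cancel, leaving [- xs x <= s]. *)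
- intros [x xs] r s Hf Hg. specialize (Hg x I); unfold h in Hg; simpl in Hg.
  rewrite linear_opp in Hg by apply dfun_lin. apply Hfge in Hf. lra.
- destruct (dual_prod_repr X L HXr) as (z & zs & HL).
  (* On graph points the two minorant inequalities say that the Fitzpatrick function of [A] at
     [(z, zs)] is at most [- c], and that of [G] at [(z, - zs)] at most [c]. *)
  assert (Hf : f (z, zs) (- c)).
  { intros [a b] Hab; unfold k; simpl in *.
    pose proof (HLf _ _ (HAf a b Hab)) as H. rewrite HL in H. lra. }
  assert (Hg : forall y, - zs y + G y z - c <= G y y).
  { intro y. pose proof (HLg _ _ (HGg y)) as H. rewrite HL in H.
    rewrite linear_opp in H by apply dfun_lin. lra. }
  (* Together these force [zs z = - c]. *)
  pose proof (Hg z) as Hgz. pose proof (Hfge _ _ _ Hf) as Hfz.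
  exists z, zs; split.
  + apply (HfA z zs (- c)); [assumption|lra].
  + intro y; unfold pairing. rewrite !linear_sub by apply dfun_lin.
    specialize (Hg y). lra.
Qed.

Theorem theorem2p3 (X : NormedSpace) (HX : reflexive_Banach X)
  (F : X -> dual X) (A : setop X)
  (HFmax : maximal_monotone (graph_of F))
  (HFstrict : strictly_monotone F)
  (HF3 : three_star_monotone F)
  (HFsurj : surjective_op F)
  (HA : monotone A) :
  maximal_monotone A <-> range_sum_full A F.
Proof.
split.
- intros HAm ys.
  pose (G := fun x => dual_add (F x) (dual_scal (-1) ys)).
  destruct (three_star_sum_zero X A G HX HAm) as (z & zs & Hz & Hy).
  + intros x xs y xs' -> ->; unfold pairing, G; simpl.
    pose proof (proj1 HFmax x (F x) y (F y) eq_refl eq_refl) as H.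
    unfold pairing in H. lra.
  + intros x xs. destruct (HF3 x (dual_add xs ys)) as [M HM].
    exists M; intro y. specialize (HM y). unfold pairing, G in *; simpl in *. lra.
  + exists z, zs; split; [assumption|]. intro x.
    (* Undoing the translation, [ys - zs] is monotonically related at [z] to the graph of [F], so
       maximality identifies it with [F z]. *)
    enough (dual_add ys (dual_scal (-1) zs) = F z) as <- by (simpl; ring).
    apply (maximal_monotone_mem X (graph_of F)); [assumption|].
    intros y _ ->. specialize (Hy y). unfold pairing, G in *; simpl in *. lra.
- intro Hran. split; [assumption|].
  intros B HB HAB x xs HBx.
  destruct (Hran (dual_add xs (F x))) as (y & ys & Hy & E). simpl in E.
  (* By [E], the pairings of [x - y] with [xs - ys] and with [F x - F y] are opposite; the first is
     nonnegative as [B] is monotone, the second positive if [x] and [y] differ. *)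
  assert (x = y) as <-.
  { apply NNPP; intro Hxy.
    pose proof (HFstrict x y Hxy) as H1.
    pose proof (HB _ _ _ _ HBx (HAB _ _ Hy)) as H2.
    specialize (E (ns_sub x y)). unfold pairing in *. lra. }
  replace xs with ys; [assumption|].
  apply dual_ext; intro z. specialize (E z). lra.
Qed.
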